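(* Let $p,q\in\mathbb{N}$ be co-prime and $\theta=\tan^{-1}(p/q)$. Then $\dim(\mu_\theta)<1$.
   Context: Throughout, $p,q\in\mathbb{N}$ are co-prime with $p/q\in[0,1]$. Let $D=\{0,1,p/q\}$. The measure $\mu_\theta$ is the unique Borel probability measure on $\mathbb{R}$ satisfying $\mu_\theta(A)=\tfrac13\big(\mu_\theta(2A)+\mu_\theta(2A-1)+\mu_\theta(2A-p/q)\big)$ for all Borel $A$; equivalently, the distribution of $\sum_{i\ge1}a_i2^{-i}$ with $a_i$ i.i.d. uniform on $D$ (the projection of the uniform measure on the Sierpinski triangle along lines of slope determined by $\theta$). $\dim(\mu_\theta)$ denotes the (Hausdorff) dimension of the measure $\mu_\theta$ (self-similar measures are exact dimensional, so the usual notions of dimension of a measure coincide). *)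

(* Defs.v *)
From HB Require Import structures.
From mathcomp Require Import all_boot all_order all_algebra.
From mathcomp Require Import all_classical all_reals all_analysis.
Set Implicit Arguments. Unset Strict Implicit. Unset Printing Implicit Defensive.
Import Order.TTheory GRing.Theory Num.Theory.
Local Open Scope classical_set_scope.
Local Open Scope ring_scope.

(* s-dimensional delta-Hausdorff content of a set A of reals: infimum of
   sum_i diam(U_i)^s over countable covers of A by closed intervals
   U_i = [a_i, b_i] of diameter b_i - a_i <= delta.  (On R every set of
   diameter d lies in a closed interval of diameter d, so interval covers
   give the usual Hausdorff content.) *)
Definition hcontent (R : realType) (s delta : R) (A : set R) : \bar R :=
  ereal_inf [set (\sum_(0 <= i <oo) (((ab.2 i - ab.1 i) `^ s)%:E))%E
            | ab in [set ab : (nat -> R) * (nat -> R) |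
                      (forall i, 0 <= ab.2 i - ab.1 i <= delta) /\
                      A `<=` \bigcup_i `[ab.1 i, ab.2 i]%classic]].

Definition hmeasure (R : realType) (s : R) (A : set R) : \bar R :=
  ereal_sup [set hcontent s delta A | delta in [set delta : R | 0 < delta]].

Definition hdim (R : realType) (A : set R) : \bar R :=
  ereal_inf [set s%:E | s in [set s : R | 0 < s /\ hmeasure s A = 0%E]].

Definition dim_meas (R : realType) (mu : set R -> \bar R) : \bar R :=
  ereal_inf [set hdim A | A in [set A : set R | measurable A /\ mu (~` A) = 0%E]].

(* Main.v *)
(* With digits scaled by q, level-n prefixes of the expansion give the integers
   S = sum_(i < n) b_i 2^i with b_i uniform in {0, p, q}.  If z is a primitive
   2^l-th root of unity with l <= n, then E z^S is the product of the trinomials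
   (1 + w^p + w^q) / 3 over l successive square roots w leading up to z.  None of
   these vanishes, since 1 + w^p + w^q = 0 forces w^p to be a primitive cube root
   of unity, and they tend to 1 geometrically, so |E z^S| is bounded below
   uniformly in l.  These characters are orthogonal on {0, .., q 2^n - 1}; by
   Bessel, S charges a set of density O(1/n) with mass bounded away from 0.
   Hoelder then gives sum_k P(S = k)^s < 2^(n (1 - s)) for some n and some s < 1.
   So mu is self-similar with ratio 2^-n and weights w_k = P(S = k) satisfying
   sum_k w_k^s 2^(-n (1 - s)) < 1: at the N-th iterate, all but exponentially
   little of the mass lies in the few cylinders of weight at least 2^(-a n N),
   with a < 1, and their limsup set has full measure and dimension below 1. *)
Require Import Defs.
From HB Require Import structures.
From mathcomp Require Import all_boot all_order all_algebra.
From mathcomp Require Import algC.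
From mathcomp Require Import all_classical all_reals all_analysis.
From mathcomp Require Import measurable_realfun.
From mathcomp Require Import ring lra zify.
Set Implicit Arguments. Unset Strict Implicit. Unset Printing Implicit Defensive.
Import Order.TTheory GRing.Theory Num.Theory.
Import numFieldNormedType.Exports.
Local Open Scope classical_set_scope.
Local Open Scope ring_scope.

(** * Digit sums and their characters *)

(** Repetitions are kept: a value [k] occurs once per digit string producing it, so its multiplicity
    over [3 ^ n] is P(S = k). *)
Fixpoint digit_sums (p q n : nat) : seq nat :=
  if n is m.+1 then
    [seq (2 * k + d)%N | k <- digit_sums p q m, d <- [:: 0; p; q]]
  else [:: 0%N].

(** The summand [q] on the left lets the induction close, since 2k + d + q <= 2(k + q); for q > 0 it
    also keeps [k] strictly below [q * 2 ^ n]. *)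
Lemma digit_sums_le p q n k :
  (p <= q)%N -> k \in digit_sums p q n -> (k + q <= q * 2 ^ n)%N.
Proof.
move=> pq; elim: n k => [|n IH] k; first by rewrite inE muln1 => /eqP->.
case/allpairsP => -[i d] [/= /IH ilt]; rewrite !inE expnS.
by move=> + -> => /or3P[] /eqP ->; nia.
Qed.

Lemma sum_digit_sumsS (V : nmodType) p q n (F : nat -> V) :
  \sum_(k <- digit_sums p q n.+1) F k =
  \sum_(k <- digit_sums p q n) (F (2 * k)%N + F (2 * k + p)%N + F (2 * k + q)%N).
Proof.
by rewrite big_allpairs_dep /=; apply: eq_bigr => k _; rewrite !big_cons big_nil /= addr0 addn0 addrA.
Qed.

Lemma size_digit_sums p q n : size (digit_sums p q n) = (3 ^ n)%N.
Proof.
rewrite -sum1_size; elim: n => [|n IH]; first by rewrite big_seq1.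
by rewrite sum_digit_sumsS expnS -IH big_distrr.
Qed.

(* The square root of nonnegative real part when |z| = 1: this keeps the dyadic
   roots converging to 1. *)
Definition half_root (z : algC) : algC :=
  let y := sqrtC z in if `|1 - y| <= `|1 + y| then y else - y.

Definition dyadic_root (l : nat) : algC :=
  if l is m.+1 then iter m half_root (-1) else 1.

Lemma half_rootK z : half_root z ^+ 2 = z.
Proof. by rewrite /half_root; case: ifP => _; rewrite ?sqrrN sqrtCK. Qed.

Lemma dyadic_rootK l : dyadic_root l.+1 ^+ 2 = dyadic_root l.
Proof.
case: l => [|l]; first by rewrite /= sqrrN expr1n.
exact: half_rootK.
Qed.

Lemma dyadic_root_exp l n : dyadic_root (n + l) ^+ (2 ^ n) = dyadic_root l.
Proof.
elim: n => [|n IH]; first by rewrite add0n expn0 expr1.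
by rewrite expnS exprM addSn dyadic_rootK.
Qed.

Lemma dyadic_root_exp1 l n : (l <= n)%N -> dyadic_root l ^+ (2 ^ n) = 1.
Proof.
move=> ln; rewrite -(subnK ln) addnC expnD exprM.
by rewrite -[X in dyadic_root X]addn0 dyadic_root_exp expr1n.
Qed.

Lemma norm_dyadic_root l : `|dyadic_root l| = 1.
Proof.
apply/eqP; rewrite -(@pexpr_eq1 _ _ (2 ^ l)) ?expn_gt0 //.
by rewrite -normrX dyadic_root_exp1 // normr1.
Qed.

Lemma parallelogram (y : algC) : `|y| = 1 -> `|1 - y| ^+ 2 + `|1 + y| ^+ 2 = 4.
Proof.
move=> y1; rewrite !normCK rmorphB rmorphD rmorph1.
have yy : y * y^* = 1 by rewrite -normCK y1 expr1n.
have -> : (1 - y) * (1 - y^*) + (1 + y) * (1 + y^*) = 2 + 2 * (y * y^*) by ring.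
rewrite yy; ring.
Qed.

Lemma half_root_dist (z : algC) : `|half_root z| = 1 ->
  `|1 - half_root z| <= 3 / 4 * `|1 - z|.
Proof.
set y := half_root z => y1.
have yz : y ^+ 2 = z := half_rootK z.
have le : `|1 - y| <= `|1 + y|.
  rewrite /y /half_root; case: ifP => // /negbT; rewrite opprK -real_ltNge ?normr_real //.
  exact: ltW.
(* The larger of the two factors has square at least 2, and 4/3 is a rational number below sqrt
   2. *)
have h : 4 / 3 <= `|1 + y|.
  rewrite -(@ler_pXn2r _ 2) ?nnegrE ?divr_ge0 ?ler0n //.
  have : 4 <= `|1 + y| ^+ 2 + `|1 + y| ^+ 2.
    by rewrite -(parallelogram y1) lerD2r lerXn2r ?nnegrE.
  rewrite -mulr2n -[leRHS]mulr_natl => h2.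
  have two0 : (0 : algC) < 2 by rewrite ltr0n.
  rewrite -(ler_pM2l two0); apply: le_trans h2.
  rewrite expr_div_n mulrA ler_pdivrMr ?exprn_gt0 ?ltr0n //.
  by rewrite -!natrX -!natrM ler_nat.
have -> : 1 - z = (1 - y) * (1 + y) by rewrite -yz; ring.
rewrite normrM.
have -> : 3 / 4 * (`|1 - y| * `|1 + y|) = `|1 - y| * (3 / 4 * `|1 + y|) by ring.
rewrite ler_peMr //; apply: le_trans (_ : 3 / 4 * (4 / 3) <= _); last by rewrite ler_wpM2l // divr_ge0 ?ler0n.
by have -> : 3 / 4 * (4 / 3) = 1 :> algC by field.
Qed.

Lemma dyadic_root_dist l : `|1 - dyadic_root l.+1| <= 2 * (3 / 4) ^+ l.
Proof.
elim: l => [|l IH]; first by rewrite /= opprK expr0 mulr1 ger0_norm ?addr_ge0.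
have /half_root_dist le : `|half_root (dyadic_root l.+1)| = 1 := norm_dyadic_root l.+2.
apply: le_trans le _; by rewrite exprS mulrCA ler_wpM2l ?divr_ge0 ?ler0n.
Qed.

Lemma unit_norm_sub_exp (z : algC) k : `|z| = 1 -> `|1 - z ^+ k| <= k%:R * `|1 - z|.
Proof.
move=> z1; rewrite -[1 in leLHS](expr1n _ k) subrXX normrM mulrC ler_wpM2r //.
apply: le_trans (ler_norm_sum _ _ _) _.
rewrite -[leRHS]mulr1 mulr_natl -[k in leRHS]card_ord -sumr_const ler_sum // => i _.
by rewrite expr1n mul1r normrX z1 expr1n.
Qed.

Lemma root_expn_eq1 (z : algC) k : z ^+ (2 ^ k) = 1 -> z ^+ 3 = 1 -> z = 1.
Proof.
move=> z2 z3; have /eqP : coprime 3 (2 ^ k) by rewrite coprimeXr.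
case: (egcdnP (2 ^ k) (isT : (0 < 3)%N)) => u v e _ g; rewrite g in e.
have : z ^+ (u * 3) = z ^+ (v * 2 ^ k + 1) by rewrite e.
by rewrite mulnC exprM z3 exprD mulnC exprM z2 !expr1n mul1r expr1.
Qed.

(* If 1 + z + w = 0 with |z| = |w| = 1, conjugating gives z w = 1, hence z^3 = 1,
   while z is also a root of unity of order a power of 2. *)
Lemma dyadic_root_trinomial_neq0 p q l :
  1 + dyadic_root l ^+ p + dyadic_root l ^+ q != 0.
Proof.
apply/eqP; set z := _ ^+ p; set w := _ ^+ q => h.
have nz : z * z^* = 1 by rewrite -normCK normrX norm_dyadic_root !expr1n.
have nw : w * w^* = 1 by rewrite -normCK normrX norm_dyadic_root !expr1n.
have hc : 1 + z^* + w^* = 0 by have := congr1 Num.conj h; rewrite !rmorphD rmorph1 rmorph0.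
have wE : w = - 1 - z by have -> : w = 1 + z + w - 1 - z; [ring | rewrite h; ring].
have zw : z * w = 1.
  have : z * w * (1 + z^* + w^*) = 0 by rewrite hc mulr0.
  have -> : z * w * (1 + z^* + w^*) = z * w + w * (z * z^*) + z * (w * w^*) by ring.
  rewrite nz nw wE => e.
  have -> : z * (- 1 - z) = z * (- 1 - z) + (- 1 - z) * 1 + z * 1 + 1 by ring.
  by rewrite e add0r.
have z3 : z ^+ 3 = 1.
  have -> : z ^+ 3 = 1 - (z - 1) * (z * (- 1 - z) - 1) by ring.
  by rewrite -wE zw subrr mulr0 subr0.
have z1 : z = 1.
  apply: (@root_expn_eq1 _ l) => //.
  by rewrite -exprM mulnC exprM dyadic_root_exp1 // expr1n.
move: h zw; rewrite z1 mul1r => /[swap] ->; apply/eqP.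
have -> : 1 + 1 + 1 = 3%:R :> algC by ring.
by rewrite pnatr_eq0.
Qed.

(** * Fourier coefficients of the digit sums at dyadic roots of unity *)

Definition trinomial_mean (p q : nat) (z : algC) : algC := (1 + z ^+ p + z ^+ q) / 3.

(** This is E z^S at z = [dyadic_root l] for every n >= l: the remaining factors are evaluated at 1
    and equal 1. *)
Definition fourier_coef p q l : algC :=
  \prod_(j < l) trinomial_mean p q (dyadic_root j.+1).

(** Summing over the lowest digit factors out the trinomial at z and replaces z by z^2, the
    preceding dyadic root. *)
Lemma sum_dyadic_root p q n l : (l <= n)%N ->
  \sum_(k <- digit_sums p q n) dyadic_root l ^+ k = (3 ^ n)%:R * fourier_coef p q l.
Proof.
elim: n l => [|n IH] l ln.
  by move: ln; rewrite leqn0 => /eqP ->; rewrite big_seq1 /fourier_coef big_ord0 mulr1.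
rewrite sum_digit_sumsS; set z := dyadic_root l.
under eq_bigr => k _.
  have -> : z ^+ (2 * k) + z ^+ (2 * k + p) + z ^+ (2 * k + q) =
    (1 + z ^+ p + z ^+ q) * (z ^+ 2) ^+ k by rewrite [z ^+ (2 * k + p)]exprD [z ^+ (2 * k + q)]exprD exprM; ring.
  over.
(* At index 0 the root is 1, fixed by squaring, and the trinomial is just 3. *)
rewrite -mulr_sumr expnS natrM /z; case: l ln @z => [|l] ln /=.
  have /= := IH 0%N isT; rewrite /fourier_coef !big_ord0 (expr1n _ 2) => ->.
  by rewrite !expr1n; ring.
rewrite -[iter l _ _]/(dyadic_root l.+1) dyadic_rootK IH //.
by rewrite /fourier_coef big_ord_recr /= /trinomial_mean /=; field.
Qed.

Lemma trinomial_mean_le1 p q l : `|trinomial_mean p q (dyadic_root l)| <= 1.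
Proof.
rewrite normrM normfV (ger0_norm (ler0n _ 3)) ler_pdivrMr ?ltr0n // mul1r.
apply: le_trans (ler_normD _ _) _; rewrite [3]mulrSr lerD //; last first.
  by rewrite normrX norm_dyadic_root expr1n.
apply: le_trans (ler_normD _ _) _; rewrite [2]mulrSr lerD ?normr1 //.
by rewrite normrX norm_dyadic_root expr1n.
Qed.

Lemma trinomial_mean_ge p q l :
  1 - (p + q)%:R * (3 / 4) ^+ l <= `|trinomial_mean p q (dyadic_root l.+1)|.
Proof.
set z := dyadic_root _; rewrite lerBlDr -lerBlDl.
have := lerB_dist 1 (trinomial_mean p q z); rewrite normr1 => /le_trans; apply.
have -> : 1 - trinomial_mean p q z = ((1 - z ^+ p) + (1 - z ^+ q)) / 3.
  by rewrite /trinomial_mean; field.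
rewrite normrM normfV (ger0_norm (ler0n _ 3)) ler_pdivrMr ?ltr0n //.
apply: le_trans (ler_normD _ _) _.
have z1 : `|z| = 1 := norm_dyadic_root l.+1.
apply: le_trans (lerD (unit_norm_sub_exp _ z1) (unit_norm_sub_exp _ z1)) _.
rewrite -mulrDl -natrD -[leRHS]mulrA; rewrite ler_wpM2l // (le_trans (dyadic_root_dist l)) //.
by rewrite mulrC ler_wpM2l ?exprn_ge0 ?divr_ge0 ?ler0n // ler_nat.
Qed.

Lemma fourier_coefS p q l : fourier_coef p q l.+1 =
  fourier_coef p q l * trinomial_mean p q (dyadic_root l.+1).
Proof. by rewrite /fourier_coef big_ord_recr. Qed.

Lemma fourier_coef_neq0 p q l : fourier_coef p q l != 0.
Proof.
apply/prodf_neq0 => j _; rewrite mulf_neq0 ?invr_eq0 ?pnatr_eq0 //.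
exact: dyadic_root_trinomial_neq0.
Qed.

Lemma norm_fourier_coef_le p q i l : (i <= l)%N ->
  `|fourier_coef p q l| <= `|fourier_coef p q i|.
Proof.
move=> /subnKC <-; elim: (l - i)%N => [|m IH]; first by rewrite addn0.
rewrite addnS fourier_coefS normrM; apply: le_trans IH.
by rewrite ler_piMr // trinomial_mean_le1.
Qed.

Lemma norm_fourier_coef_le1 p q l : `|fourier_coef p q l| <= 1.
Proof.
by apply: le_trans (norm_fourier_coef_le _ _ (leq0n l)) _; rewrite /fourier_coef big_ord0 normr1.
Qed.

(** Bernoulli's inequality (4/3)^J >= 1 + J/3, cleared of denominators and taken at J = 24 D. *)
Lemma geometric_small (D : nat) : exists J, (8 * D * 3 ^ J <= 4 ^ J)%N.
Proof.
exists (24 * D)%N.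
have h J : ((3 + J) * 3 ^ J <= 3 * 4 ^ J)%N.
  by elim: J => // J IH; rewrite !expnS; nia.
by have := h (24 * D)%N; nia.
Qed.

Lemma fourier_coef_bounded_below p q :
  exists2 d : algC, 0 < d & forall l, d <= `|fourier_coef p q l|.
Proof.
have [J hJ] := geometric_small (p + q).
(* [x i] is the sum of the deficits (p + q) (3/4)^j over all j >= J + i; the choice of [J] makes
   [x 0] at most 1/2. *)
pose c := fourier_coef p q; pose x i : algC := 4 * (p + q)%:R * (3 / 4) ^+ (J + i).
have x0 i : 0 <= x i by rewrite !mulr_ge0 ?exprn_ge0 ?divr_ge0 ?ler0n.
have xS i : x i.+1 = 3 / 4 * x i by rewrite /x addnS exprS; ring.
have x12 i : x i <= 1 / 2.
  elim: i => [|i IH].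
    rewrite /x addn0 expr_div_n mulrA ler_pdivrMr ?exprn_gt0 ?ltr0n //.
    rewrite [leRHS]mulrAC mul1r ler_pdivlMr ?ltr0n // -!natrX -!natrM ler_nat; lia.
  rewrite xS (le_trans _ IH) // ler_piMl // ler_pdivrMr ?ltr0n // mul1r ler_nat //.
have cJ : 0 < `|c J| by rewrite normr_gt0 fourier_coef_neq0.
(* The surplus [x i] pays for the factors still to come: one step multiplies by at least 1 - x_i /
   4, and the slack is x_i / 4 (1/2 - x_i) >= 0. *)
have lb i : `|c J| * (1 / 2 + x i) <= `|c (J + i)%N|.
  elim: i => [|i IH].
    rewrite addn0 ler_piMr // (le_trans (lerD (lexx _) (x12 0%N))) //.
    by have -> : 1 / 2 + 1 / 2 = 1 :> algC by field.
  have e : (p + q)%:R * (3 / 4) ^+ (J + i) = x i / 4 by rewrite /x; field.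
  have := trinomial_mean_ge p q (J + i); rewrite e => h.
  rewrite addnS /c fourier_coefS normrM.
  have h0 : 0 <= 1 - x i / 4.
    rewrite subr_ge0 ler_pdivrMr ?ltr0n // mul1r (le_trans (x12 i)) //.
    by rewrite ler_pdivrMr ?ltr0n // -natrM ler1n.
  have h1 : 0 <= `|c J| * (1 / 2 + x i) by rewrite mulr_ge0 // addr_ge0 // divr_ge0 ?ler0n.
  apply: le_trans (ler_pM h1 h0 IH h); rewrite -mulrA ler_wpM2l // -subr_ge0 xS.
  have -> : (1 / 2 + x i) * (1 - x i / 4) - (1 / 2 + 3 / 4 * x i) = x i / 4 * (1 / 2 - x i).
    by field.
  by rewrite mulr_ge0 ?divr_ge0 ?ler0n // subr_ge0.
exists (`|c J| / 2); first by rewrite divr_gt0 ?ltr0n.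
move=> l; case: (leqP J l) => [/subnKC <-|/ltnW lJ].
  apply: le_trans (lb _); rewrite mulrDr mul1r lerDl mulr_ge0 //.
apply: le_trans (norm_fourier_coef_le p q lJ).
by rewrite ler_pdivrMr ?ltr0n // ler_peMr // ler1n.
Qed.

(** * Orthogonality of the dyadic characters and concentration of the digit sums *)

Lemma dyadic_root_inj : injective dyadic_root.
Proof.
suff lt_neq l m : (l < m)%N -> dyadic_root l != dyadic_root m.
  move=> l m e; apply/eqP; case: (ltngtP l m) => // /lt_neq; first by rewrite e eqxx.
  by rewrite e eqxx.
(* The power 2^m sends the root of lower index to 1 and the root of index m + 1 to -1. *)
case: m => // m; rewrite ltnS => lm; apply/eqP => /(congr1 (fun z => z ^+ (2 ^ m))).
rewrite dyadic_root_exp1 // -[in RHS]addn1 dyadic_root_exp /= => /eqP.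
by rewrite -subr_eq0 opprK -[1 + 1]/(2%:R) pnatr_eq0.
Qed.

(** The ratio u of two distinct roots satisfies u^(q 2^n) = 1 and u <> 1, so its geometric sum
    vanishes. *)
Lemma dyadic_root_orthogonal q n l m : (0 < q)%N -> (l < n)%N -> (m < n)%N ->
  \sum_(k < q * 2 ^ n) dyadic_root l ^+ k * (dyadic_root m ^+ k)^* =
    if l == m then (q * 2 ^ n)%:R else 0.
Proof.
move=> q0 ln mn; set z := dyadic_root l; set w := dyadic_root m.
have nw : w * w^* = 1 by rewrite -normCK norm_dyadic_root expr1n.
under eq_bigr do rewrite rmorphXn -exprMn.
case: eqVneq => [lm|lm].
  have -> : z * w^* = 1 by rewrite /z lm.
  by under eq_bigr do rewrite expr1n; rewrite sumr_const card_ord.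
have h1 : (z * w^*) ^+ (q * 2 ^ n) = 1.
  rewrite mulnC exprM exprMn -rmorphXn !dyadic_root_exp1 ?rmorph1 ?mulr1 ?expr1n //; exact: ltnW.
have /eqP : (z * w^* - 1) * (\sum_(k < q * 2 ^ n) (z * w^*) ^+ k) = 0.
  by rewrite -subrX1 h1 subrr.
rewrite mulf_eq0 subr_eq0 => /orP[/eqP e|/eqP//].
case/eqP: lm; apply: dyadic_root_inj; rewrite -/z -/w.
by rewrite -[z]mulr1 -nw mulrCA e mulr1.
Qed.

(** A test function for Chebyshev's inequality: its mean under the law of S is sum |c_l|^2, of order
    n, while its mean square over the integers below q 2^n is at most n. *)
Definition bessel_sum p q n (k : nat) : algC :=
  \sum_(l < n) (fourier_coef p q l)^* * dyadic_root l ^+ k.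

Lemma bessel p q n : (0 < q)%N ->
  \sum_(k < q * 2 ^ n) `|bessel_sum p q n k| ^+ 2 <= (q * 2 ^ n * n)%:R.
Proof.
move=> q0; pose c := fourier_coef p q.
have -> : \sum_(k < q * 2 ^ n) `|bessel_sum p q n k| ^+ 2 =
    \sum_(l < n) `|c l| ^+ 2 * (q * 2 ^ n)%:R.
  under eq_bigr => k _.
    rewrite normCK rmorph_sum mulr_suml.
    under eq_bigr do rewrite mulr_sumr.
    over.
  rewrite exchange_big; apply: eq_bigr => l _; rewrite exchange_big /=.
  have inner (m : 'I_n) : \sum_(k < q * 2 ^ n) (c l)^* * dyadic_root l ^+ k *
      ((c m)^* * dyadic_root m ^+ k)^* =
      (c l)^* * c m * (if l == m :> nat then (q * 2 ^ n)%:R else 0).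
    rewrite -(dyadic_root_orthogonal q0 (ltn_ord l) (ltn_ord m)) mulr_sumr.
    by apply: eq_bigr => k _; rewrite rmorphM /= conjCK; ring.
  rewrite (eq_bigr _ (fun m _ => inner m)) (bigD1 l) //= big1 ?addr0 => [|m ml].
    by rewrite eqxx normCKC.
  by rewrite eq_sym (inj_eq val_inj) (negPf ml) mulr0.
rewrite -mulr_suml [leRHS]natrM mulrC ler_wpM2l // -[n in leRHS]card_ord -sumr_const ler_sum // => l _.
by rewrite expr_le1 // norm_fourier_coef_le1.
Qed.

Lemma bessel_sum_le p q n k : `|bessel_sum p q n k| <= n%:R.
Proof.
apply: le_trans (ler_norm_sum _ _ _) _.
rewrite -[n in leRHS]card_ord -sumr_const ler_sum // => l _.
by rewrite normrM normrX norm_dyadic_root expr1n mulr1 norm_conjC norm_fourier_coef_le1.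
Qed.

Lemma sum_bessel_sum p q n : \sum_(k <- digit_sums p q n) bessel_sum p q n k =
  (3 ^ n)%:R * \sum_(l < n) `|fourier_coef p q l| ^+ 2.
Proof.
rewrite exchange_big mulr_sumr; apply: eq_bigr => l _ /=.
by rewrite -mulr_sumr sum_dyadic_root ?(ltnW (ltn_ord l)) // normCK; ring.
Qed.

Lemma sum_ge_count (s : seq nat) (B : pred nat) (F : nat -> algC) a :
  (forall k, k \in s -> 0 <= F k) -> (forall k, B k -> a <= F k) ->
  a * (count B s)%:R <= \sum_(k <- s) F k.
Proof.
move=> F0 FB; rewrite -sum1_count natr_sum mulr_sumr big_mkcond big_seq [leRHS]big_seq.
by apply: ler_sum => k ks; case: ifP => [/FB|_]; rewrite ?mulr1 // F0.
Qed.

(** [K] comes before [M]: the mass of [B] stays at least 1/K while its density drops to 1/M. This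
    order lets s be fixed before n. *)
Lemma digit_sums_concentrate p q : (0 < q)%N ->
  exists K : nat, forall M : nat, exists n (B : pred nat),
    (M * count B (iota 0 (q * 2 ^ n)) <= q * 2 ^ n)%N /\
    (3 ^ n <= K * count B (digit_sums p q n))%N.
Proof.
move=> q0; have [d d0 hd] := fourier_coef_bounded_below p q.
(* As |c_l| >= d, the mean of the test function is at least 2 a n; half of this serves as
   threshold. *)
pose a := d ^+ 2 / 2; have a0 : 0 < a by rewrite divr_gt0 ?exprn_gt0 ?ltr0n.
pose K := Num.bound a^-1.
have aK : 1 <= a * K%:R.
  rewrite mulrC -ler_pdivrMr // mul1r ltW //; apply: archi_boundP.
  by rewrite invr_ge0 ltW.
exists K => M; pose n := (M * K ^ 2).+1.
have n0 : 0 < n%:R :> algC by rewrite ltr0n.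
pose B k := a * n%:R <= `|bessel_sum p q n k|; exists n, B; split.
  (* Chebyshev: the count is at most q 2^n / (a^2 n), and a K >= 1 with n > M K^2 gives a^2 n >=
     M. *)
  have h : (a * n%:R) ^+ 2 * (count B (iota 0 (q * 2 ^ n)))%:R <= (q * 2 ^ n * n)%:R.
    apply: le_trans (bessel p n q0).
    rewrite -(big_mkord xpredT (fun k => `|bessel_sum p q n k| ^+ 2)) /index_iota subn0.
    apply: sum_ge_count => k; first by rewrite exprn_ge0.
    by move=> Bk; rewrite lerXn2r ?nnegrE // mulr_ge0 // ltW.
  rewrite -(ler_nat algC) -(ler_pM2r n0) -[leRHS]natrM; apply: le_trans h.
  rewrite natrM mulrAC ler_wpM2r // exprMn expr2 [leRHS]mulrA ler_wpM2r ?ler0n //.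
  apply: le_trans (_ : a ^+ 2 * (M * K ^ 2)%:R <= _); last first.
    by rewrite ler_wpM2l ?exprn_ge0 ?(ltW a0) // ler_nat.
  rewrite natrM natrX mulrCA -exprMn ler_peMr //.
  by rewrite exprn_ege1.
rewrite -(ler_nat algC) natrM.
have h : (3 ^ n)%:R * (n%:R * d ^+ 2) <= \sum_(k <- digit_sums p q n) `|bessel_sum p q n k|.
  apply: le_trans (ler_norm_sum _ _ _); rewrite sum_bessel_sum normrM.
  rewrite ger0_norm // ler_wpM2l // ger0_norm; last by apply: sumr_ge0 => l _; rewrite exprn_ge0.
  rewrite -[n in leLHS]card_ord mulr_natl -sumr_const ler_sum // => l _.
  by rewrite lerXn2r ?nnegrE // ltW.
(* On [B] the trivial bound n applies, off [B] the threshold a n; hence 2 a n <= n P(B) + a n, and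
   P(B) >= a >= 1/K. *)
have h2 : \sum_(k <- digit_sums p q n) `|bessel_sum p q n k| <=
    \sum_(k <- digit_sums p q n) ((if B k then n%:R else 0) + a * n%:R).
  apply: ler_sum => k _; case: ifPn => [_|].
    by rewrite (le_trans (bessel_sum_le _ _ _ _)) // lerDl mulr_ge0 // ltW.
  have ra : a * n%:R \is Num.real by rewrite ger0_real // mulr_ge0 // ltW.
  by rewrite add0r -real_ltNge ?normr_real // => /ltW.
have := le_trans h h2.
have -> : \sum_(k <- digit_sums p q n) ((if B k then n%:R else 0) + a * n%:R) =
    n%:R * (count B (digit_sums p q n))%:R + a * n%:R * (3 ^ n)%:R.
  rewrite big_split /= -big_mkcond -(size_digit_sums p q) -sum1_size -sum1_count.
  by rewrite !natr_sum !mulr_sumr; congr (_ + _); apply: eq_bigr => k _; rewrite mulr1.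
have -> : d ^+ 2 = 2 * a by rewrite /a mulrC divfK ?pnatr_eq0.
rewrite -lerBlDr => h3.
have {}h3 : a * (3 ^ n)%:R <= (count B (digit_sums p q n))%:R.
  rewrite -(ler_pM2l n0); apply: le_trans h3; rewrite le_eqVlt; apply/orP; left.
  by apply/eqP; ring.
apply: le_trans (_ : K%:R * (a * (3 ^ n)%:R) <= _); last by rewrite ler_wpM2l.
by rewrite mulrA [K%:R * a]mulrC ler_peMl.
Qed.

(** * A power-sum bound *)

Lemma powR_young (R : realType) (x y s : R) : 0 <= x -> 0 <= y -> 0 < s < 1 ->
  x `^ s * y `^ (1 - s) <= s * x + (1 - s) * y.
Proof.
move=> x0 y0 /andP[s0 s1]; have s1' : 0 < 1 - s by rewrite subr_gt0.
have := @conjugate_powR R (x `^ s) (y `^ (1 - s)) s^-1 (1 - s)^-1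
  (powR_ge0 _ _) (powR_ge0 _ _).
rewrite !invr_gt0 !invrK -!powRrM !mulfV ?gt_eqF // !powRr1 // [s + _]addrC subrK.
by move=> /(_ s0 s1' erefl); rewrite [x * s]mulrC [y * _]mulrC.
Qed.

(** Hoelder's inequality against a constant: Young's inequality is applied to each weight and the
    average P / m, and (P / m)^(1 - s) is divided out. *)
Lemma sum_powR_le (R : realType) (T : Type) (r : seq T) (w : T -> R) (s m P : R) :
  0 < s < 1 -> (forall x, 0 <= w x) -> 0 < m -> 0 < P ->
  (size r)%:R <= m -> \sum_(x <- r) w x <= P ->
  \sum_(x <- r) w x `^ s <= m `^ (1 - s) * P `^ s.
Proof.
move=> s01 w0 m0 P0 rm wP; have /andP[s0 s1] := s01.
have a0 : 0 < P / m by rewrite divr_gt0.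
have h : (\sum_(x <- r) w x `^ s) * (P / m) `^ (1 - s) <= P.
  rewrite mulr_suml.
  apply: (@le_trans _ _ (\sum_(x <- r) (s * w x + (1 - s) * (P / m)))).
    by apply: ler_sum => x _; apply: powR_young => //; exact: ltW.
  rewrite big_split /= -mulr_sumr big_const_seq count_predT iter_addr_0 -mulr_natr.
  have h1 : (1 - s) * (P / m) * (size r)%:R <= (1 - s) * P.
    rewrite -mulrA ler_wpM2l ?subr_ge0 ?(ltW s1) //.
    by rewrite mulrAC ler_pdivrMr // ler_wpM2l // ltW.
  have h2 : s * (\sum_(x <- r) w x) <= s * P by rewrite ler_wpM2l // ltW.
  by lra.
rewrite -(ler_pM2r (powR_gt0 (1 - s) a0)) (le_trans h) // le_eqVlt; apply/orP; left; apply/eqP.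
rewrite mulrAC -powRM ?(ltW m0) ?(ltW a0) // [m * _]mulrC divfK ?gt_eqF //.
by rewrite -powRD ?subrK ?powRr1 ?(ltW P0) // gt_eqF ?implybT.
Qed.

Lemma sum_undup (R : realType) (s : seq nat) (B : pred nat) :
  \sum_(k <- undup s | B k) (count_mem k s)%:R = (count B s)%:R :> R.
Proof.
rewrite -natr_sum -sum1_count -[in RHS]big_undup_iterop_count; congr (_%:R).
by apply: eq_bigr => k _; rewrite Monoid.iteropE iter_addn_0 mul1n.
Qed.

Lemma exists_small_powR (R : realType) (x e a : R) : 0 <= x -> 0 < e -> 0 < a ->
  exists M : nat, (0 < M)%N /\ (x / M%:R) `^ a < e.
Proof.
move=> x0 e0 a0; pose b := e `^ a^-1; have b0 : 0 < b := powR_gt0 _ e0.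
exists (Num.bound (x / b)).+1; split => //.
have xM : x / (Num.bound (x / b)).+1%:R < b.
  rewrite ltr_pdivrMr ?ltr0n // mulrC -ltr_pdivrMr //.
  by rewrite (lt_trans (archi_boundP _)) ?divr_ge0 ?(ltW b0) // ltr_nat.
have -> : e = b `^ a by rewrite -powRrM mulVf ?gt_eqF // powRr1 // ltW.
by apply: gt0_ltr_powR => //; rewrite ?nnegrE ?divr_ge0 ?(ltW b0).
Qed.

(** Put eta = 1 - s. Hoelder on [B] and off [B] bounds the product by (q/M)^eta + q^eta (1 - kap)^(1
    - eta). Young's inequality bounds the second term by 1 - kap/2 when eta q = kap/2, and M then
    makes the first less than kap/2. *)
Lemma digit_sums_moment (R : realType) (p q : nat) : (0 < q)%N -> (p <= q)%N ->
  exists (n : nat) (s : R), 0 < s < 1 /\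
    (\sum_(k <- undup (digit_sums p q n))
       ((count_mem k (digit_sums p q n))%:R / (3 ^ n)%:R) `^ s)
    * ((2 ^ n)%:R^-1) `^ (1 - s) < 1.
Proof.
move=> q0 pq; have [K hK] := digit_sums_concentrate p q0.
(* [K.+1] rather than [K] gives kap <= 1/2, so that the mass bound 1 - kap off [B] is positive. *)
pose kap : R := K.+1%:R^-1; have kap0 : 0 < kap by rewrite invr_gt0 ltr0n.
have kap1 : kap <= 1 by rewrite invf_le1 ?ltr0n // ler1n.
have q0' : 0 < q%:R :> R by rewrite ltr0n.
have q1 : 1 <= q%:R :> R by rewrite ler1n.
pose eta := kap / (2 * q%:R).
have eta0 : 0 < eta by rewrite divr_gt0 // mulr_gt0.
have etaq : eta * q%:R = kap / 2 by rewrite /eta; field; rewrite gt_eqF.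
have eta1 : eta < 1 by nra.
have s01 : 0 < 1 - eta < 1 by lra.
have K0 : (0 < K)%N.
  have [n [B [_]]] := hK 0%N; case: (K) => //.
  by rewrite mul0n leqn0 expn_eq0.
have kap12 : kap <= 1 / 2.
  by rewrite /kap ler_pdivlMr ?ltr0n // mulrC ler_pdivrMr ?ltr0n // mul1r ler_nat ltnS.
have [M [M0 hM]] : exists M : nat, (0 < M)%N /\ (q%:R / M%:R) `^ eta < kap / 2.
  by apply: exists_small_powR => //; rewrite divr_gt0.
have [n [B [B1 B2]]] := hK M; exists n, (1 - eta); split => //.
have -> : 1 - (1 - eta) = eta by ring.
set V := digit_sums p q n; pose w k : R := (count_mem k V)%:R / (3 ^ n)%:R.
have w0 k : 0 <= w k by rewrite divr_ge0.
have sumw (C : pred nat) : \sum_(k <- undup V | C k) w k = (count C V)%:R / (3 ^ n)%:R.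
  by rewrite -mulr_suml sum_undup.
have t0 : 0 < (3 ^ n)%:R :> R by rewrite ltr0n expn_gt0.
have t20 : 0 < (2 ^ n)%:R :> R by rewrite ltr0n expn_gt0.
pose Q : R := q%:R * (2 ^ n)%:R; have Q0 : 0 < Q by rewrite mulr_gt0.
have sizeV (C : pred nat) : (size [seq k <- undup V | C k] <= count C (iota 0 (q * 2 ^ n)))%N.
  rewrite -size_filter; apply: uniq_leq_size; first by rewrite filter_uniq ?undup_uniq.
  move=> k; rewrite !mem_filter mem_iota add0n mem_undup => /andP[-> /(digit_sums_le pq)] /=.
  by move=> h; apply: leq_trans h; rewrite -addn1 leq_add2l.
have hoelder (r : seq nat) (m P : R) : 0 < m -> 0 < P ->
    (size r)%:R <= m -> \sum_(k <- r) w k <= P ->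
    \sum_(k <- r) w k `^ (1 - eta) <= m `^ eta * P `^ (1 - eta).
  move=> m0 P0 rm rP; rewrite -[X in m `^ X](subKr 1).
  exact: sum_powR_le.
have SB : \sum_(k <- undup V | B k) w k `^ (1 - eta) <= (Q / M%:R) `^ eta.
  have e11 : 1 `^ (1 - eta) = 1 :> R by rewrite powR1.
  rewrite -big_filter -[leRHS]mulr1 -[X in _ <= _ * X]e11.
  apply: hoelder => //.
  - by rewrite divr_gt0 // ltr0n.
  - rewrite ler_pdivlMr ?ltr0n // /Q -!natrM ler_nat mulnC.
    by rewrite (leq_trans _ B1) // leq_mul2l sizeV orbT.
  - rewrite big_filter sumw ler_pdivrMr // mul1r ler_nat.
    by rewrite -(size_digit_sums p q) count_size.
have SC : \sum_(k <- undup V | ~~ B k) w k `^ (1 - eta) <= Q `^ eta * (1 - kap) `^ (1 - eta).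
  rewrite -big_filter; apply: hoelder => //.
  - by lra.
  - rewrite /Q -natrM ler_nat (leq_trans (sizeV _)) //.
    by rewrite (leq_trans (count_size _ _)) // size_iota.
  - rewrite big_filter sumw ler_pdivrMr // mulrBl mul1r lerBrDr.
    have : (count B V + count (predC B) V = 3 ^ n)%N.
      by rewrite count_predC size_digit_sums.
    move=> e; rewrite -[in leRHS]e natrD addrC lerD2r.
    rewrite mulrC ler_pdivrMr ?ltr0n // -natrM ler_nat (leq_trans B2) //.
    by rewrite mulnC leq_mul2l leqnSn orbT.
rewrite (bigID B) /= mulrDl.
have i0 : 0 <= (2 ^ n)%:R^-1 :> R by rewrite invr_ge0 ltW.
have e1 : (Q / M%:R) `^ eta * (2 ^ n)%:R^-1 `^ eta = (q%:R / M%:R) `^ eta.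
  rewrite -powRM ?divr_ge0 ?(ltW Q0) //; congr (_ `^ _); rewrite /Q; field.
  by rewrite !gt_eqF // ltr0n.
have e2 : Q `^ eta * (1 - kap) `^ (1 - eta) * (2 ^ n)%:R^-1 `^ eta =
    q%:R `^ eta * (1 - kap) `^ (1 - eta).
  rewrite mulrAC -powRM ?(ltW Q0) //; congr (_ `^ _ * _); rewrite /Q; field.
  by rewrite gt_eqF.
have := ler_wpM2r (powR_ge0 (2 ^ n)%:R^-1 eta) SB; rewrite e1 => h1.
have := ler_wpM2r (powR_ge0 (2 ^ n)%:R^-1 eta) SC; rewrite e2 => h2.
have h3 : q%:R `^ eta * (1 - kap) `^ (1 - eta) <= eta * q%:R + (1 - eta) * (1 - kap).
  by apply: powR_young; rewrite ?ler0n ?subr_ge0 //; lra.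
have h4 : (1 - eta) * (1 - kap) <= 1 - kap by nra.
apply: le_lt_trans (lerD h1 h2) _.
rewrite etaq in h3; lra.
Qed.

(** * Self-similar systems and Hausdorff dimension *)

Lemma measurable_affine_preimage (R : realType) (r t : R) (A : set R) :
  measurable A -> measurable ((fun y => r * y + t) @^-1` A).
Proof.
move=> mA; rewrite -[X in measurable X]setTI.
have : measurable_fun [set: R] (fun y => r * y + t) by apply: measurable_funD => //; exact: measurable_funM.
by apply.
Qed.

(* [L] lists (weight, translation) pairs: [mu] is the weighted sum of its images
   under the maps y |-> r y + t. *)
Definition represents (R : realType) (mu : set R -> \bar R) (r : R) (L : seq (R * R)) :=
  forall A : set R, measurable A ->
    (mu A = \sum_(x <- L) x.1%:E * mu ((fun y => (r * y + x.2)%R) @^-1` A))%E.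

(** The outer maps come from [L1] and have ratio [r], which scales the translations of [L2]. *)
Definition sys_comp (R : realType) (r : R) (L1 L2 : seq (R * R)) : seq (R * R) :=
  [seq (x.1 * z.1, x.2 + r * z.2) | x <- L1, z <- L2].

Fixpoint sys_pow (R : realType) (r : R) (L : seq (R * R)) (n : nat) : seq (R * R) :=
  if n is m.+1 then sys_comp r L (sys_pow r L m) else [:: (1, 0)].

Definition nonneg_weights (R : realType) (L : seq (R * R)) := {in L, forall x, 0 <= x.1}.

Lemma sys_comp_nonneg (R : realType) (r : R) (L1 L2 : seq (R * R)) :
  nonneg_weights L1 -> nonneg_weights L2 -> nonneg_weights (sys_comp r L1 L2).
Proof.
by move=> L10 L20 x /allpairsP[[y z] /= [/L10 y0 /L20 z0 ->]]; rewrite mulr_ge0.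
Qed.

Lemma sys_pow_nonneg (R : realType) (r : R) (L : seq (R * R)) n :
  nonneg_weights L -> nonneg_weights (sys_pow r L n).
Proof.
move=> L0; elim: n => [|n IH] /=; last exact: sys_comp_nonneg.
by move=> x; rewrite inE => /eqP ->.
Qed.

Lemma represents_comp (R : realType) (mu : {measure set R -> \bar R}) (r1 r2 : R)
    (L1 L2 : seq (R * R)) : nonneg_weights L2 ->
  represents mu r1 L1 -> represents mu r2 L2 ->
  represents mu (r1 * r2) (sys_comp r1 L1 L2).
Proof.
move=> L20 h1 h2 A mA; rewrite h1 // big_allpairs_dep /=; apply: eq_bigr => x _.
rewrite h2; last exact: measurable_affine_preimage.
rewrite big_seq ge0_sume_distrr => [|z zL]; last by rewrite mule_ge0 // lee_fin L20.
rewrite [RHS]big_seq; apply: eq_bigr => z _; rewrite muleA -EFinM; congr (_ * mu _)%E.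
by apply/seteqP; split => y /=; rewrite mulrDr -mulrA -addrA [_ + x.2]addrC.
Qed.

Lemma represents_pow (R : realType) (mu : {measure set R -> \bar R}) (r : R)
    (L : seq (R * R)) n : nonneg_weights L ->
  represents mu r L -> represents mu (r ^+ n) (sys_pow r L n).
Proof.
move=> L0 h; elim: n => [|n IH] /=.
  move=> A mA; rewrite big_seq1 /= mul1e; congr (mu _).
  by apply/seteqP; split => y /=; rewrite expr0 mul1r addr0.
by rewrite exprS; apply: represents_comp => //; exact: sys_pow_nonneg.
Qed.

(** A multiplicative [F] covers both uses: total weight, with the identity, and s-th moment, with a
    real power. *)
Lemma sum_sys_pow (R : realType) (r : R) (L : seq (R * R)) (F : R -> R) n :
  F 1 = 1 -> (forall x y, 0 <= x -> 0 <= y -> F (x * y) = F x * F y) ->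
  nonneg_weights L ->
  \sum_(x <- sys_pow r L n) F x.1 = (\sum_(x <- L) F x.1) ^+ n.
Proof.
move=> F1 FM L0; elim: n => [|n IH] /=; first by rewrite big_seq1.
rewrite big_allpairs_dep /= exprS -IH mulr_suml big_seq [RHS]big_seq.
apply: eq_bigr => x xL; rewrite mulr_sumr big_seq [RHS]big_seq.
by apply: eq_bigr => z zL; rewrite FM ?(L0 x) ?(sys_pow_nonneg L0 zL).
Qed.

Definition heavy (R : realType) (t : R) (L : seq (R * R)) := [seq x <- L | t <= x.1].

Lemma size_heavy (R : realType) (t : R) (L : seq (R * R)) : nonneg_weights L ->
  (size (heavy t L))%:R * t <= \sum_(x <- L) x.1.
Proof.
move=> L0; rewrite size_filter -sum1_count natr_sum mulr_suml big_mkcond.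
rewrite big_seq [leRHS]big_seq; apply: ler_sum => x /L0 x0.
by case: ifP; rewrite ?mul1r.
Qed.

(** A weight x < t satisfies x = x^(1 - s) x^s <= t^(1 - s) x^s, so the s-th moment controls the
    discarded mass. *)
Lemma sum_heavy (R : realType) (t s : R) (L : seq (R * R)) : nonneg_weights L ->
  0 < t -> 0 < s < 1 ->
  \sum_(x <- L) x.1 - t `^ (1 - s) * \sum_(x <- L) x.1 `^ s <= \sum_(x <- heavy t L) x.1.
Proof.
move=> L0 t0 /andP[s0 s1]; rewrite big_filter lerBlDr [in leRHS]big_mkcond mulr_sumr -big_split /=.
rewrite big_seq [leRHS]big_seq; apply: ler_sum => x /L0 x0; case: ifPn => [_|].
  by rewrite lerDl mulr_ge0 // powR_ge0.
rewrite -ltNge add0r => xt.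
rewrite -[leLHS](powRr1 x0) -{1}(subrK s 1) powRD; last by rewrite subrK oner_eq0.
rewrite ler_wpM2r ?powR_ge0 // ge0_ler_powR ?nnegrE ?(ltW t0) ?(ltW xt) //; lra.
Qed.

(** When [d] is the ratio of the system, these intervals are the images of [0, 1] under its maps. *)
Definition cover_set (R : realType) (d : R) (L : seq (R * R)) : set R :=
  \bigcup_(x in [set` L]) `[x.2, x.2 + d]%classic.

Lemma measurable_cover_set (R : realType) (d : R) (L : seq (R * R)) :
  measurable (cover_set d L).
Proof. by apply: fin_bigcup_measurable => // x _; exact: measurable_itv. Qed.

(** The preimage of the cover under a heavy map contains [0, 1], hence has mass 1; the light terms
    are dropped. *)
Lemma cover_set_ge (R : realType) (mu : probability R R) (r : R) (L : seq (R * R)) (t : R) :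
  0 <= r -> mu `[0, 1]%classic = 1%E -> nonneg_weights L -> represents mu r L ->
  ((\sum_(x <- heavy t L) x.1)%:E <= mu (cover_set r (heavy t L)))%E.
Proof.
move=> r0 mu01 L0 h; rewrite h; last exact: measurable_cover_set.
rewrite /heavy -sumEFin big_filter big_mkcond big_seq [leRHS]big_seq.
apply: lee_sum => x xL; case: ifPn => [tx|_]; last by rewrite mule_ge0 // lee_fin L0.
rewrite -[leLHS]mule1 lee_wpmul2l ?lee_fin ?L0 // -mu01 le_measure ?inE //.
- by apply: measurable_affine_preimage; exact: measurable_cover_set.
- move=> y /=; rewrite ?in_itv /= => /andP[y0 y1]; exists x.
    by rewrite /= mem_filter tx.
  by rewrite /= in_itv /=; apply/andP; split; nra.
Qed.

(** * Upper bounds for Hausdorff content *)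

Lemma nneseries_le (R : realType) (u : nat -> \bar R) (c : \bar R) :
  (forall i, 0 <= u i)%E -> (forall n, \sum_(0 <= i < n) u i <= c)%E ->
  (\sum_(0 <= i <oo) u i <= c)%E.
Proof.
move=> u0 uc; apply: lime_le; first by apply: is_cvg_nneseries.
by apply: nearW => n; exact: uc.
Qed.

Lemma nneseries_pair (R : realType) (a : nat * nat -> \bar R) (f : nat -> nat * nat) :
  (forall i, 0 <= a i)%E -> set_bij [set: nat] [set: nat * nat] f ->
  (\sum_(0 <= k <oo) a (f k) = \sum_(0 <= i <oo) \sum_(0 <= j <oo) a (i, j))%E.
Proof.
move=> a0 fb; rewrite nneseries_esumT // -(reindex_esum _ _ _ a fb).
rewrite nneseries_esumT; last by move=> i; exact: nneseries_ge0.
under [RHS]eq_esum do rewrite nneseries_esumT //.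
rewrite esum_esum //; congr (esum _ _); last by apply/funext => -[].
by apply/seteqP; split.
Qed.

Lemma hcontent_le (R : realType) (s delta c : R) (d : nat -> R)
    (L : nat -> seq (R * R)) (A : set R) : 0 < s ->
  (forall N, 0 <= d N <= delta) -> A `<=` \bigcup_N cover_set (d N) (L N) ->
  (forall n, \sum_(0 <= N < n) (size (L N))%:R * d N `^ s <= c) ->
  (hcontent s delta A <= c%:E)%E.
Proof.
move=> s0 d0 AL hc; have /card_esym/ppcard_eqP[f] := card_nat2.
(* The finite families are flattened along a bijection of nat with nat * nat; slots past the end of
   a list get length 0, which costs 0^s = 0 because s > 0. *)
pose len (k : nat * nat) := if (k.2 < size (L k.1))%N then d k.1 else 0.
pose left (k : nat * nat) := (nth (0, 0) (L k.1) k.2).2.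
have len0 k : 0 <= len k <= delta.
  rewrite /len; case: ifP => // _; rewrite lexx /=.
  by have /andP[/le_trans] := d0 0%N; apply.
apply: (@le_trans _ _ (\sum_(0 <= k <oo) (len (f k) `^ s)%:E)%E).
  apply: ereal_inf_lbound => /=.
  exists (fun k => left (f k), fun k => left (f k) + len (f k)) => /=; last first.
    by apply: eq_eseriesr => k _; rewrite addrAC subrr add0r.
  split => [k|x /AL[N _ [y yL xy]]]; first by rewrite addrAC subrr add0r.
  exists (f^-1%FUN (N, index y (L N))) => //=.
  rewrite invK ?inE // /left /len /= index_mem.
  by move: yL => /= yL; rewrite yL nth_index.
rewrite (@nneseries_pair _ (fun k => (len k `^ s)%:E)); last 2 first.
- by move=> k; rewrite lee_fin powR_ge0.
- exact: bij.
apply: nneseries_le => [N|n].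
  by apply: nneseries_ge0 => j _ _; rewrite lee_fin powR_ge0.
apply: (@le_trans _ _ (\sum_(0 <= N < n) ((size (L N))%:R * d N `^ s)%:E)%E); last first.
  by rewrite sumEFin lee_fin.
apply: lee_sum => N _; apply: nneseries_le => [j|m]; first by rewrite lee_fin powR_ge0.
rewrite sumEFin lee_fin /len /=.
have -> : \sum_(0 <= j < m) (if (j < size (L N))%N then d N else 0) `^ s =
    \sum_(0 <= j < m | (j < size (L N))%N) d N `^ s.
  rewrite [RHS]big_mkcond; apply: eq_bigr => j _; case: ifP => // _.
  by rewrite powR0 // gt_eqF.
rewrite big_const_seq iter_addr_0 -[leLHS]mulr_natl ler_wpM2r ?powR_ge0 // ler_nat.
rewrite -size_filter -[leqRHS](size_iota 0); apply: uniq_leq_size.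
  by rewrite filter_uniq ?iota_uniq.
by move=> j; rewrite mem_filter mem_iota => /andP[].
Qed.

Lemma hmeasure_eq0 (R : realType) (s : R) (A : set R) :
  (forall delta e : R, 0 < delta -> 0 < e -> (hcontent s delta A <= e%:E)%E) ->
  hmeasure s A = 0%E.
Proof.
move=> h.
have content0 delta : 0 < delta -> hcontent s delta A = 0%E.
  move=> delta0; apply/eqP; rewrite eq_le; apply/andP; split.
    by apply/lee_addgt0Pr => e e0; rewrite add0e; exact: h.
  apply: le_ereal_inf_tmp => _ [ab _ <-].
  by apply: nneseries_ge0 => i _ _; rewrite lee_fin powR_ge0.
apply/eqP; rewrite eq_le; apply/andP; split.
  by apply: ge_ereal_sup => _ [delta /= delta0 <-]; rewrite content0.
by apply: ereal_sup_ubound; exists 1 => /=; rewrite ?content0.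
Qed.

(** Continuity in the exponent at 1, made explicit: for a = 1 - b, x^a = x y^b with y = 1/x, and
    Young's inequality gives y^b <= b y + 1 - b. *)
Lemma exists_powR_lt1 (R : realType) (z x : R) : 0 <= z -> 0 < x < 1 -> z * x < 1 ->
  exists2 a, 0 < a < 1 & z * x `^ a < 1.
Proof.
move=> z0 /andP[x0 x1] zx.
pose y := x^-1; have y1 : 1 < y by rewrite invf_gt1.
have y0 : 0 < y by rewrite invr_gt0.
pose b := (1 - z * x) / (2 * y).
have zx0 : 0 <= z * x by rewrite mulr_ge0 // ltW.
have b0 : 0 < b by rewrite divr_gt0 ?mulr_gt0 // subr_gt0.
have byE : b * y = (1 - z * x) / 2 by rewrite /b; field; rewrite gt_eqF.
have b1 : b < 1 by nra.
exists (1 - b); first by lra.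
have -> : x `^ (1 - b) = x * y `^ b.
  by rewrite powRB ?(gt_eqF x0) ?implybT // powRr1 ?(ltW x0) // /y -(powR_inv1 (ltW x0)) -powRrM mulN1r powRN.
have := @powR_young R y 1 b (ltW y0) ler01; rewrite b0 b1 => /(_ isT).
rewrite powR1 mulr1 mulr1 byE => h.
have : z * x * y `^ b <= z * x * ((1 - z * x) / 2 + (1 - b)) by rewrite ler_wpM2l.
rewrite mulrA => /le_lt_trans; apply; nra.
Qed.

Lemma geometric_tail_le (R : realType) (b : R) M n : 0 < b < 1 ->
  \sum_(0 <= i < n) b ^+ (M + i) <= b ^+ M / (1 - b).
Proof.
move=> /andP[b0 b1]; have b1' : 0 < 1 - b by rewrite subr_gt0.
rewrite ler_pdivlMr // mulrC big_mkord.
under eq_bigr do rewrite exprD.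
rewrite -mulr_sumr mulrCA -[1 - b]opprB mulNr -subrX1 opprB.
by rewrite ler_piMr ?exprn_ge0 ?(ltW b0) // gerBl exprn_ge0 // ltW.
Qed.

Lemma exists_exprn_le (R : realType) (b e : R) : 0 < b < 1 -> 0 < e ->
  exists M, b ^+ M <= e.
Proof.
move=> /andP[b0 b1] e0.
have : (fun n => b ^+ n) @ \oo --> (0 : R) by apply: cvg_expr; rewrite ger0_norm // ltW.
move/cvgrPdist_le => /(_ _ e0) [M _ hM]; exists M.
by have := hM M (leqnn M); rewrite sub0r normrN ger0_norm // exprn_ge0 // ltW.
Qed.

(** For each M the complement of the union lies in that of every [A (M + N)], of mass at most b^(M +
    N), which tends to 0 in N. *)
Lemma probability_limsup (R : realType) (mu : probability R R) (A : nat -> set R) (b : R) :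
  0 < b < 1 -> (forall n, measurable (A n)) ->
  (forall n, ((1 - b ^+ n)%:E <= mu (A n))%E) ->
  mu (~` \bigcap_M \bigcup_N A (M + N)%N) = 0%E.
Proof.
move=> b01 mA hA; rewrite setC_bigcap.
have mC M : measurable (~` \bigcup_N A (M + N)%N).
  by apply: measurableC; exact: bigcup_measurable.
apply/negligibleP; first exact: bigcup_measurable.
apply: negligible_bigcup => M; apply/negligibleP => //.
apply/eqP; rewrite eq_le measure_ge0 andbT; apply/lee_addgt0Pr => e e0; rewrite add0e.
have [N hN] := exists_exprn_le b01 e0.
apply: (@le_trans _ _ (mu (~` A (M + N)%N))).
  apply: le_measure; rewrite ?inE //; first exact: measurableC.
  by apply: subsetC => x Ax; exists N.
rewrite probability_setC //.
have := hA (M + N)%N; rewrite -(fineK (fin_num_measure mu _ (mA (M + N)%N))) -EFinB !lee_fin => h.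
have : b ^+ (M + N) <= b ^+ N.
  have /andP[b0 b1] := b01.
  by rewrite exprD ler_piMl ?exprn_ge0 ?exprn_ile1 // ltW.
lra.
Qed.

Lemma dim_meas_lt1 (R : realType) (mu : probability R R) (r s : R) (L : seq (R * R)) :
  0 < r < 1 -> 0 < s < 1 -> mu `[0, 1]%classic = 1%E -> nonneg_weights L ->
  represents mu r L -> \sum_(x <- L) x.1 = 1 ->
  (\sum_(x <- L) x.1 `^ s) * r `^ (1 - s) < 1 ->
  (dim_meas mu < 1%:E)%E.
Proof.
move=> r01 s01 mu01 L0 hL sumL; set z := \sum_(x <- L) _ => zr.
have /andP[r0 r1] := r01; have /andP[s0 s1] := s01.
have z0 : 0 <= z by apply: sumr_ge0 => x _; exact: powR_ge0.
have pow_in01 u : 0 < u -> 0 < r `^ u < 1.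
  move=> u0; rewrite powR_gt0 //= -[ltRHS](powRr0 r).
  by rewrite /powR gt_eqF // ltr_expR mul0r pmulr_rlt0 // ln_lt0 // r01.
have s1' : 0 < 1 - s by rewrite subr_gt0.
have [a /andP[a0 a1]] := exists_powR_lt1 z0 (pow_in01 _ s1') zr.
rewrite powRAC; set tau := r `^ a => za.
have /andP[tau0 tau1] : 0 < tau < 1 := pow_in01 _ a0.
pose b := (1 + z * tau `^ (1 - s)) / 2.
have zt0 : 0 <= z * tau `^ (1 - s) by rewrite mulr_ge0 // powR_ge0.
have b01 : 0 < b < 1 by rewrite /b; lra.
(* At most tau^(-N) cylinders of level N reach the threshold, and they miss mass at most (z tau^(1 -
   s))^N <= b^N. *)
pose E N := heavy (tau ^+ N) (sys_pow r L N).
have pow0 N : nonneg_weights (sys_pow r L N) by exact: sys_pow_nonneg.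
have pow1 N : \sum_(x <- sys_pow r L N) x.1 = 1.
  by rewrite (@sum_sys_pow _ _ _ id) // sumL expr1n.
have pows N : \sum_(x <- sys_pow r L N) x.1 `^ s = z ^+ N.
  by rewrite (@sum_sys_pow _ _ _ (fun x => x `^ s)) ?powR1 // => x y *; rewrite powRM.
pose A := \bigcap_M \bigcup_N cover_set (r ^+ (M + N)) (E (M + N)%N).
have mA : measurable A.
  apply: bigcap_measurable => // M _; apply: bigcup_measurable => N _.
  exact: measurable_cover_set.
have muA : mu (~` A) = 0%E.
  apply: (@probability_limsup _ _ (fun N => cover_set (r ^+ N) (E N)) b) => // N.
    exact: measurable_cover_set.
  apply: le_trans (cover_set_ge _ _ mu01 (pow0 N) (represents_pow N L0 hL)); last first.
    by rewrite exprn_ge0 // ltW.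
  rewrite lee_fin; apply: le_trans (sum_heavy (pow0 N) (exprn_gt0 N tau0) s01).
  rewrite pow1 pows lerB // -(@powR_mulrn _ tau) ?(ltW tau0) // powRAC powR_mulrn ?powR_ge0 //.
  rewrite -exprMn lerXn2r ?nnegrE ?mulr_ge0 ?powR_ge0 //; rewrite /b mulrC; lra.
(* For t strictly between a and 1, level N costs at most tau^(-N) r^(t N) = r^((t - a) N), the term
   of a convergent geometric series. *)
pose t := (1 + a) / 2; have t1 : t < 1 by rewrite /t; lra.
have t0 : 0 < t by rewrite /t; lra.
suff h : hmeasure t A = 0%E.
  apply: (@le_lt_trans _ _ t%:E); last by rewrite lte_fin.
  apply: (@le_trans _ _ (hdim A)); apply: ereal_inf_lbound.
    by exists A.
  by exists t.
have beta01 : 0 < r `^ (t - a) < 1 by apply: pow_in01; rewrite /t; lra.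
apply: hmeasure_eq0 => delta e delta0 e0.
set beta := r `^ (t - a) in beta01; have /andP[beta0 beta1] := beta01.
have beta1' : 0 < 1 - beta by rewrite subr_gt0.
(* [M1] brings the lengths below [delta], [M2] the geometric tail below [e]; starting at level M1 +
   M2 does both. *)
have [M1 hM1] := exists_exprn_le r01 delta0.
have [M2 hM2] := exists_exprn_le beta01 (mulr_gt0 e0 beta1').
pose M := (M1 + M2)%N.
apply: (@hcontent_le _ _ _ _ (fun N => r ^+ (M + N)) (fun N => E (M + N)%N)) => //.
- move=> N; rewrite exprn_ge0 ?(ltW r0) //= (le_trans _ hM1) //.
  by rewrite /M -addnA exprD ler_piMr ?exprn_ge0 ?exprn_ile1 ?(ltW r0) ?(ltW r1).
- by move=> x /(_ M I).
move=> n; apply: (@le_trans _ _ (\sum_(0 <= N < n) beta ^+ (M + N))).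
  apply: ler_sum => N _; set m := (M + N)%N.
  have hs := size_heavy (tau ^+ m) (pow0 m); rewrite pow1 in hs.
  have -> : (r ^+ m) `^ t = tau ^+ m * beta ^+ m.
    rewrite -exprMn /tau /beta -powRD ?(gt_eqF r0) ?implybT //.
    by rewrite addrC subrK -(@powR_mulrn _ r) ?(ltW r0) // powRAC powR_mulrn ?powR_ge0.
  by rewrite mulrA ler_piMl // exprn_ge0 // ltW.
apply: le_trans (geometric_tail_le M n beta01) _.
rewrite ler_pdivrMr // (le_trans _ hM2) //.
by rewrite /M exprD ler_piMl ?exprn_ge0 ?exprn_ile1 ?(ltW beta0) ?(ltW beta1).
Qed.

(** * The measure of the theorem *)

(** The sets 2A - d are written as preimages under x |-> (x + d) / 2, so that measurability comes
    from the affine maps. *)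
Definition self_similar (R : realType) (mu : set R -> \bar R) (c : R) :=
  forall A : set R, measurable A ->
    (mu A = (1 / 3 : R)%:E * (mu ((fun x => 2^-1 * x)%R @^-1` A)
       + mu ((fun x => 2^-1 * x + 2^-1)%R @^-1` A)
       + mu ((fun x => 2^-1 * x + c / 2)%R @^-1` A)))%E.

Lemma image_double_sub (R : realType) (c : R) (A : set R) :
  [set 2 * x - c | x in A] = (fun x => 2^-1 * x + c / 2) @^-1` A.
Proof.
apply/seteqP; split => [_ [x Ax <-]|x /= Ax].
  by rewrite /preimage /=; have -> : 2^-1 * (2 * x - c) + c / 2 = x by field.
by exists (2^-1 * x + c / 2) => //; field.
Qed.

Lemma self_similar_image (R : realType) (mu : set R -> \bar R) (c : R) :
  (forall A : set R, measurable A ->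
     mu A = ((1 / 3 : R)%:E * (mu [set (2 * x)%R | x in A] + mu [set (2 * x - 1)%R | x in A]
         + mu [set (2 * x - c)%R | x in A]))%E) -> self_similar mu c.
Proof.
move=> h A mA; rewrite h // !image_double_sub [1 / 2]div1r.
have -> : [set 2 * x | x in A] = [set 2 * x - 0 | x in A].
  by apply: eq_imagel => x _; rewrite subr0.
have -> : [set 2 * x - 0 | x in A] = (fun x => 2^-1 * x) @^-1` A.
  by rewrite image_double_sub; apply/seteqP; split => x /=; rewrite mul0r addr0.
by [].
Qed.

(* The maps x |-> (x + d) / 2, 0 <= d <= 1, halve the excess u of a point over
   the interval [0, 1]. *)
Definition far (R : realType) (u : R) : set R := [set x | 1 / 2 + u < `|x - 1 / 2|].

Lemma measurable_far (R : realType) (u : R) : measurable (far u).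
Proof.
have mf : measurable_fun [set: R] (fun x : R => `|x - 1 / 2|).
  by apply: measurableT_comp => //; exact: measurable_funB.
have := mf measurableT _ (measurable_itv `]1 / 2 + u, +oo[); rewrite setTI.
congr measurable; apply/seteqP.
by split => x; rewrite /far /= in_itv /= andbT.
Qed.

(** For 0 <= d <= 1 the map x |-> (x + d) / 2 moves 1/2 by at most 1/4, so a point whose image has
    excess over u has itself excess over 2u. *)
Lemma self_similar_far (R : realType) (mu : probability R R) (c u : R) :
  0 <= c <= 1 -> self_similar mu c -> (mu (far u) <= mu (far (2 * u)))%E.
Proof.
move=> c01 h; rewrite h; last exact: measurable_far.
have le d : 0 <= d <= 1 -> (mu ((fun x => 2^-1 * x + d / 2)%R @^-1` far u) <= mu (far (2 * u)))%E.
  move=> d01; apply: le_measure; rewrite ?inE; last 2 first.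
  - exact: measurable_far.
  - rewrite /far => x /=; rewrite !ltr_normr => /orP[] hx; apply/orP; [left|right]; lra.
  by apply: measurable_affine_preimage; exact: measurable_far.
have fin : mu (far (2 * u)) \is a fin_num by apply: fin_num_measure; exact: measurable_far.
apply: (@le_trans _ _ ((1 / 3)%:E * (mu (far (2 * u)) + mu (far (2 * u)) + mu (far (2 * u))))%E).
  rewrite lee_wpmul2l ?lee_fin ?divr_ge0 // !leeD // ?le //; last 1 first.
  - by have := le 1; rewrite div1r; apply; rewrite ler01 lexx.
  have := le 0; rewrite mul0r lexx ler01 => /(_ isT); congr (mu _ <= _)%E.
  by apply/seteqP; split => x /=; rewrite addr0.
rewrite -(fineK fin) -!EFinD -EFinM lee_fin; lra.
Qed.

(** Iterated doubling of u cannot decrease the mass, yet the sets [far (2 ^+ n * u)] decrease to the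
    empty set: continuity from above concludes. *)
Lemma self_similar_far0 (R : realType) (mu : probability R R) (c u : R) :
  0 <= c <= 1 -> self_similar mu c -> 0 < u -> mu (far u) = 0%E.
Proof.
move=> c01 h u0; pose F n : set R := far (2 ^+ n * u).
have mF n : measurable (F n) by exact: measurable_far.
have FS n : F n.+1 `<=` F n.
  move=> x; apply: le_lt_trans; rewrite lerD2l exprS -mulrA ler_peMl ?mulr_ge0 ?exprn_ge0 ?(ltW u0) //.
  by rewrite ler1n.
have cap : \bigcap_n F n = set0.
  apply/seteqP; split => // x hx.
  have := hx (Num.bound (`|x - 1 / 2| / u)) I; rewrite /F /far /=.
  set k := Num.bound _.
  have : `|x - 1 / 2| / u < k%:R by apply: archi_boundP; rewrite divr_ge0 // ltW.
  rewrite ltr_pdivrMr // => h1 h2.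
  have : k%:R * u <= 2 ^+ k * u.
    by rewrite ler_pM2r // -natrX ler_nat ltnW // ltn_expl.
  lra.
have cv : mu \o F @ \oo --> (0 : \bar R).
  rewrite -(@measure0 _ _ _ mu) -cap; apply: nonincreasing_cvg_mu => //.
  - by rewrite -ge0_fin_numE // fin_num_measure.
  - by rewrite cap.
  - apply/nonincreasing_seqP => n; exact/subsetPset/FS.
have const n : (mu (far u) <= (mu \o F) n)%E.
  elim: n => [|n IH] /=; first by rewrite /F expr0 mul1r.
  apply: le_trans IH _; rewrite /= /F exprS -mulrA; exact: self_similar_far h.
apply/eqP; rewrite eq_le measure_ge0 andbT.
rewrite -(cvg_lim _ cv) //; apply: lime_ge; first by apply/cvg_ex; exists 0%E.
by apply: nearW.
Qed.

Lemma self_similar_support (R : realType) (mu : probability R R) (c : R) :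
  0 <= c <= 1 -> self_similar mu c -> mu `[0, 1]%classic = 1%E.
Proof.
move=> c01 h.
have null : mu (~` `[0, 1]%classic) = 0%E.
  have -> : ~` `[0, 1]%classic = \bigcup_n far (n.+1%:R^-1 : R).
    apply/seteqP; split => [x /negP|x [n _]]; last first.
      have n0 : 0 < n.+1%:R^-1 :> R by rewrite invr_gt0 ltr0n.
      move: n0; rewrite /far /= in_itv /=; set e := _^-1 => e0 hx /andP[x0 x1].
      by move: hx; apply/negP; rewrite -leNgt ler_norml; apply/andP; split; lra.
    rewrite in_itv /= => hx.
    have hx' : 0 < `|x - 1 / 2| - 1 / 2.
      rewrite ltNge; apply/negP => hn; apply: (negP hx).
      have : `|x - 1 / 2| <= 1 / 2 by lra.
      rewrite ler_norml; lra.
    exists (Num.bound (`|x - 1 / 2| - 1 / 2)^-1) => //; rewrite /far /=.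
    set k := Num.bound _.
    have hk : (`|x - 1 / 2| - 1 / 2)^-1 < k.+1%:R.
      by rewrite (lt_trans (archi_boundP _)) ?invr_ge0 ?(ltW hx') // ltr_nat.
    have : k.+1%:R^-1 < `|x - 1 / 2| - 1 / 2 by rewrite -[ltRHS]invrK ltf_pV2 ?posrE ?invr_gt0.
    by rewrite ltrBrDl.
  apply/negligibleP; first by apply: bigcup_measurable => n _; exact: measurable_far.
  apply: negligible_bigcup => n; apply/negligibleP; first exact: measurable_far.
  by apply: self_similar_far0 h _ => //; rewrite invr_gt0 ltr0n.
have m01 : measurable (`[0, 1]%classic : set R) by exact: measurable_itv.
have := probability_setC mu m01; rewrite null -(fineK (fin_num_measure mu _ m01)) -EFinB.
by move=> [e]; congr EFin; lra.
Qed.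

(** Coinciding maps are merged because the moment bound concerns the weights P(S = k); unmerged, the
    same product would be (3/2)^(n (1 - s)) >= 1. *)
Lemma represents_undup (R : realType) (mu : {measure set R -> \bar R}) (r a : R)
    (g : nat -> R) (V : seq nat) :
  represents mu r [seq (a, g k) | k <- V] ->
  represents mu r [seq ((count_mem k V)%:R * a, g k) | k <- undup V].
Proof.
move=> h A mA; rewrite h // !big_map -[LHS]big_undup_iterop_count /=.
apply: eq_bigr => k _; rewrite Monoid.iteropE EFinM -muleA mule_natl.
by elim: (count_mem k V) => // m IH; rewrite iterS IH muleS.
Qed.

(** Appending the digit 0, 1 or p/q turns k / (q 2^n) into the fraction with numerator 2k, 2k + q or
    2k + p over q 2^(n+1). *)
Lemma represents_digit_sums (R : realType) (mu : probability R R) (p q n : nat) :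
  (0 < q)%N -> self_similar mu (p%:R / q%:R) ->
  represents mu (2 ^ n)%:R^-1
    [seq ((3 ^ n)%:R^-1, k%:R / (q%:R * (2 ^ n)%:R)) | k <- digit_sums p q n].
Proof.
move=> q0 h; have q0' : q%:R != 0 :> R by rewrite pnatr_eq0 -lt0n.
elim: n => [|n IH] A mA.
  rewrite big_map big_seq1 /= expn0 invr1 mul1e; congr (mu _).
  by apply/seteqP; split => x /=; rewrite mul1r mul0r addr0.
rewrite IH // !big_map sum_digit_sumsS; apply: eq_bigr => k _ /=.
set B := _ @^-1` A; have mB : measurable B by exact: measurable_affine_preimage.
have t0 : (2 ^ n)%:R != 0 :> R by rewrite pnatr_eq0 expn_eq0.
have e3 : (3 ^ n.+1)%:R^-1 = (3 ^ n)%:R^-1 * (1 / 3) :> R.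
  by rewrite expnS natrM invfM mulrC div1r.
have pre (j : nat) (d : R) : j%:R = 2 * k%:R + d * q%:R ->
    (fun x => 2^-1 * x + d / 2) @^-1` B =
    (fun x => (2 ^ n.+1)%:R^-1 * x + j%:R / (q%:R * (2 ^ n.+1)%:R)) @^-1` A.
  move=> jE; have e x : (2 ^ n)%:R^-1 * (2^-1 * x + d / 2) + k%:R / (q%:R * (2 ^ n)%:R) =
      (2 ^ n.+1)%:R^-1 * x + j%:R / (q%:R * (2 ^ n.+1)%:R).
    by rewrite jE expnS natrM; field; rewrite q0' t0.
  by apply/seteqP; split => x; rewrite /B /= e.
rewrite (h B mB) muleA -EFinM -e3 !ge0_muleDr ?adde_ge0 //.
have e0 : (fun x => 2^-1 * x) = (fun x : R => 2^-1 * x + 0 / 2).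
  by apply/funext => x; rewrite mul0r addr0.
have e1 : (fun x => 2^-1 * x + 2^-1) = (fun x : R => 2^-1 * x + 1 / 2).
  by apply/funext => x; rewrite div1r.
rewrite e0 e1 (pre (2 * k)%N 0); last by rewrite natrM mul0r addr0.
rewrite (pre (2 * k + q)%N 1); last by rewrite natrD natrM mul1r.
rewrite (pre (2 * k + p)%N (p%:R / q%:R)); last by rewrite natrD natrM divfK.
(* The digit list puts p before q, whereas the self-similarity equation puts 1 before p/q. *)
by rewrite addeAC.
Qed.

(* theta = atan(p/q); D = {0, 1, p/q}; mu_theta is the unique Borel
   probability measure on R with
   mu(A) = 1/3 (mu(2A) + mu(2A - 1) + mu(2A - p/q)) for all Borel A. *)
Theorem theorem5p5 (R : realType) (p q : nat)
  (hpq : coprime p q) (hle : (p <= q)%N)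
  (mu : probability R R)
  (hss : forall A : set R, measurable A ->
     mu A = ((1 / 3 : R)%:E *
        (mu [set (2 * x)%R | x in A] + mu [set (2 * x - 1)%R | x in A]
         + mu [set (2 * x - p%:R / q%:R)%R | x in A]))%E) :
  (dim_meas mu < 1%:E)%E.
Proof.
have q0 : (0 < q)%N.
  by case: q hpq hle {hss} => // + p0; move: p0; rewrite leqn0 => /eqP ->.
have q0' : 0 < q%:R :> R by rewrite ltr0n.
have c01 : 0 <= (p%:R / q%:R : R) <= 1.
  by rewrite divr_ge0 //= ler_pdivrMr // mul1r ler_nat.
have h := self_similar_image hss.
have [n [s [s01 hs]]] := digit_sums_moment R q0 hle.
have rep := represents_undup (represents_digit_sums n q0 h).
(* For n = 0 the moment product equals 1; n > 0 is what makes the ratio 2^-n less than 1. *)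
have n0 : (0 < n)%N.
  case: n hs rep => // + _; rewrite /= big_seq1 /= expn0 divr1 invr1 !powR1 mulr1.
  by rewrite ltxx.
have w0 : nonneg_weights [seq ((count_mem k (digit_sums p q n))%:R * (3 ^ n)%:R^-1,
    k%:R / (q%:R * (2 ^ n)%:R) : R) | k <- undup (digit_sums p q n)].
  by move=> x /mapP[k _ ->]; rewrite divr_ge0.
apply: (dim_meas_lt1 _ s01 (self_similar_support c01 h) w0 rep).
- rewrite invr_gt0 ltr0n expn_gt0 /= invf_lt1 ?ltr0n ?expn_gt0 //.
  by rewrite ltr1n -{1}(expn0 2) ltn_exp2l.
- rewrite big_map /= -mulr_suml sum_undup count_predT size_digit_sums.
  by rewrite divff // pnatr_eq0 expn_eq0.
- by rewrite big_map.
Qed.
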